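(* Let $n\ge 3$, let $\mathbb T$ be a triangulation of a convex $n$-gon, let $i\in\mathbb Z$, and consider the base edge $v_{i-1}v_i$. Let $\{\zeta_{k,\ell}\}_{0\le \ell-k\le n+1}$ be the $q$-deformed Conway--Coxeter frieze of $\mathbb T$ and let $(r_{i,u},s_{i,u})_{u\in\mathbb Z}$ be the numerators and denominators of the anti-periodic extension of the $q$-Farey labeling of $(\mathbb T,i)$. Define $\ell_{i,j}$ for $i-1\le j\le i+n-1$ by $$\ell_{i,i-1}=0,\qquad \ell_{i,j}-\ell_{i,j-1}=\mu_{i,j}\quad(i\le j\le i+n-1),$$ where $\mu_{i,j}$ is the descendant degree of $v_j$. Then for every $j\in\mathbb Z$ with $i-1\le j\le i+n-1$, $$\zeta_{i-1,j+1}=q^{\ell_{i,j}}\,r_{i,j+1},\qquad \zeta_{i,j+1}=q^{\ell_{i,j}}\,s_{i,j+1}.$$ In particular, $\ell_{i,i}=\ell_{i,i+1}=0$, since $\mu_{i,i}=\mu_{i,i+1}=0$.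
   Context: Triangulations. Let $n\ge3$ and let $\mathcal P$ be a convex $n$-gon with vertices numbered clockwise $v_0,\dots,v_{n-1}$; indices are extended to $\mathbb Z$ by $v_{u+n}=v_u$. A triangulation $\mathbb T$ of $\mathcal P$ is a triangulation by $n-3$ non-crossing diagonals; its triangles are called cells. Let $c_u$ be the number of cells having $v_u$ as a vertex; the $n$-periodic sequence $(c_u)_{u\in\mathbb Z}$ is the quiddity of $\mathbb T$. $q$-deformed Conway--Coxeter frieze ($q$-CCF) of $\mathbb T$. For an integer $a\ge0$ put $[a]_q=1+q+\cdots+q^{a-1}$ (with $[0]_q=0$). The $q$-CCF is the array of polynomials $\zeta_{k,\ell}\in\mathbb Z[q]$, for integers $k,\ell$ with $0\le \ell-k\le n+1$, determined by $\zeta_{k,k}=0$, $\zeta_{k,k+1}=1$, $\zeta_{k,k+2}=[c_{k+1}]_q$ and, recursively for $\ell-k\ge3$, by the $q$-unimodular rule $$\zeta_{k,\ell-1}\zeta_{k+1,\ell}-\zeta_{k+1,\ell-1}\zeta_{k,\ell}=q^{\sum_{u=k+1}^{\ell-2}(c_u-1)}.$$ (In this range the divisors $\zeta_{k+1,\ell-1}$ are nonzero and the array is well defined with values in $\mathbb Z[q]$.) $q$-Farey labeling of $(\mathbb T,i)$. The base edge is $v_{i-1}v_i=v_{i+n-1}v_i$. Represent vertices by indices in $\{i,i+1,\dots,i+n-1\}$. Each cell is then uniquely $\{v_a,v_b,v_g\}$ with $i\le b<g<a\le i+n-1$ (clockwise order $v_a,v_b,v_g$); its base side is $v_av_b$ (the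 base edge itself for the cell containing the base edge; otherwise the side separating the cell from the base edge). Assign weights (powers of $q$) to sides and pairs $(r_{i,j},s_{i,j})\in\mathbb Z[q]^2$, $i\le j\le i+n-1$, to vertices as follows, starting from the base edge and proceeding from each cell to its neighbours away from the base edge. The base edge has weight $q^{-1}$, and $(r_{i,i+n-1},s_{i,i+n-1})=(0,1)$, $(r_{i,i},s_{i,i})=(1,0)$. If a cell with indices $b<g<a$ has base side $v_av_b$ of weight $q^{\ell-1}$, then $$r_{i,g}=r_{i,a}+q^{\ell}r_{i,b},\qquad s_{i,g}=s_{i,a}+q^{\ell}s_{i,b},$$ the side $v_gv_a$ gets weight $1$ and the side $v_bv_g$ gets weight $q^{\ell}$. The label of $v_j$ is $\theta_{i,j}=r_{i,j}/s_{i,j}$ (fractions are not reduced; $r_{i,j},s_{i,j}$ are the polynomials just defined). The anti-periodic extension is given by $r_{i,j+tn}=(-1)^tr_{i,j}$, $s_{i,j+tn}=(-1)^ts_{i,j}$ for $i\le j\le i+n-1$, $t\in\mathbb Z$. Descendant degree. For $i\le j\le i+n-1$, $\mu_{i,j}$ is the number of diagonals of $\mathbb T$ joining $v_j$ to a vertex $v_\alpha$ with $i\le\alpha\le j-2$. (Equivalently, if the cells at $v_j$ are numbered counterclockwise around $v_j$ as $\mathcal C_0,\mathcal C_1,\dots,\mathcal C_{c_j-1}$ starting from the one containing the edge $v_{j-1}v_j$, then $\mathcal C_{\mu_{i,j}}$ is the one with the fewest ancestors, i.e. separated from the base edge by the fewest diagonals.) *)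

(* Defs.v *)
From HB Require Import structures.
From mathcomp Require Import all_boot all_order all_algebra.

Set Implicit Arguments.
Unset Strict Implicit.
Unset Printing Implicit Defensive.

Import Order.TTheory GRing.Theory Num.Theory.
Local Open Scope ring_scope.

(* The vertices of the convex n-gon are the elements of 'Z_n, in clockwise
   order; since 'Z_n has n elements only when 1 < n, everything below is meant
   for 2 < n. The map [vtx n] realizes the extension of the indices to all
   integers by v_(u+n) = v_u. *)
Definition vtx (n : nat) (u : int) : 'Z_n := u%:~R.

Section Triangulation.
Variable n : nat.

Definition side (x y : 'Z_n) : bool := (y == x + 1) || (x == y + 1).

(* The vertices met strictly after x and strictly before y when going
   clockwise from x to y: the differences are taken in 'Z_n and compared
   through their representatives in {0, ..., n-1}. *)
Definition open_arc (x y : 'Z_n) : {set 'Z_n} :=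
  [set z : 'Z_n | (0 < val (z - x)%R)%N && (val (z - x)%R < val (y - x)%R)%N].

Definition crossing (x y z w : 'Z_n) : bool :=
  ((z \in open_arc x y) && (w \in open_arc y x)) ||
  ((w \in open_arc x y) && (z \in open_arc y x)).

(* A triangulation is given by its set of diagonals, each diagonal being the
   unordered pair of its endpoints. *)
Record is_triangulation (T : {set {set 'Z_n}}) : Prop := IsTriangulation {
  triang_diag : forall e : {set 'Z_n}, e \in T ->
    exists x y : 'Z_n, [/\ x != y, ~~ side x y & e = [set x; y]];
  triang_noncrossing : forall x y z w : 'Z_n,
    [set x; y] \in T -> [set z; w] \in T -> ~~ crossing x y z w;
  triang_card : #|T| = (n - 3)%N
}.

Variable T : {set {set 'Z_n}}.

Definition edge (x y : 'Z_n) : bool := side x y || ([set x; y] \in T).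

(* No diagonal can enter a triangle bounded by edges of the triangulation
   without crossing one of its sides, so these triangles are the cells. *)
Definition cells : {set {set 'Z_n}} :=
  [set C : {set 'Z_n} | (#|C| == 3)
     && [forall x in C, forall y in C, (x != y) ==> edge x y]].

Definition quiddity (u : int) : nat := #|[set C in cells | vtx n u \in C]|.

(* The variable q is 'X. *)
Definition qint (a : nat) : {poly int} := \sum_(j < a) 'X^j.

(* Only the values zeta k l with 0 <= l - k <= n + 1 are meaningful. In the
   exponent of the unimodular rule, u = k + 1 + t runs over k+1, ..., l-2, and
   the predecessor is c_u - 1 because every quiddity is positive. *)
Record is_qCCF (zeta : int -> int -> {poly int}) : Prop := IsQCCF {
  qCCF0 : forall k : int, zeta k k = 0;
  qCCF1 : forall k : int, zeta k (k + 1) = 1;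
  qCCF2 : forall k : int, zeta k (k + 2) = qint (quiddity (k + 1));
  qCCF_unimodular : forall k l : int, 3 <= l - k -> l - k <= n%:Z + 1 ->
    zeta k (l - 1) * zeta (k + 1) l - zeta (k + 1) (l - 1) * zeta k l
    = 'X^(\sum_(0 <= t < `|(l - k - 2)%R|) (quiddity (k + 1 + t%:Z)).-1)
}.

(* The q-Farey labeling with base edge v_(i-1) v_i. For i <= b < a <= i+n-1,
   the weight of the edge v_b v_a is q ^ (w b a), with w b a = -1 for the base
   edge; a cell b < g < a has v_a v_b as its base side. *)
Record is_qFarey (i : int) (w : int -> int -> int) (r s : int -> {poly int})
    : Prop := IsQFarey {
  qFarey_base_weight : w i (i + n%:Z - 1) = -1;
  qFarey_last : r (i + n%:Z - 1) = 0 /\ s (i + n%:Z - 1) = 1;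
  qFarey_first : r i = 1 /\ s i = 0;
  qFarey_cell : forall (b g a : int) (l : nat),
    i <= b -> b < g -> g < a -> a <= i + n%:Z - 1 ->
    [set vtx n b; vtx n g; vtx n a] \in cells ->
    w b a = l%:Z - 1 ->
    [/\ r g = r a + 'X^l * r b, s g = s a + 'X^l * s b,
        w g a = 0 & w b g = l%:Z];
  qFarey_antiperiodic : forall j t : int, i <= j -> j <= i + n%:Z - 1 ->
    r (j + t * n%:Z) = (-1) ^ t * r j /\ s (j + t * n%:Z) = (-1) ^ t * s j
}.

(* The number of diagonals joining v_j to some v_alpha with
   i <= alpha <= j - 2, where alpha = i + t. *)
Definition descendant_degree (i j : int) : nat :=
  #|[set t : 'I_n | (i + (val t)%:Z <= j - 2)
                    && ([set vtx n j; vtx n (i + (val t)%:Z)] \in T)]|.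

End Triangulation.

(* Main.v *)
(* Number the vertices from the base edge. A laminar count shows that a chord
   (b, a) cuts off at most a - b - 1 diagonals, itself and the base edge
   included, with equality only if a cell b < g < a sits below it and equality
   holds for (b, g) and (g, a); having n - 3 diagonals, the triangulation is
   therefore a binary tree of cells. Along this tree, the labels around each
   vertex v_j satisfy
     q^(mu_j) f_(j+1) = [c_j] f_j - q^(c_(j-1) - 1 - mu_(j-1)) f_(j-1)
   for f = r and f = s, so that F_j = q^(l_(j-1)) f_j satisfies
     F_(j+1) = [c_j] F_j - q^(c_(j-1) - 1) F_(j-1).
   With R and S the two sequences F, the Pluecker relation between the
   determinants R_k S_l - R_l S_k is the q-unimodular rule up to powers of q.
   These determinants are positive at q = 1, so the rule determines the
   frieze. *)
Require Import Defs.
From mathcomp Require Import all_boot all_order all_algebra.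
From mathcomp Require Import zify ring.
Import Order.TTheory GRing.Theory Num.Theory.
Local Open Scope ring_scope.

Set Implicit Arguments.
Unset Strict Implicit.
Unset Printing Implicit Defensive.

(* The polygon cut off by the chord (b, a), as a binary tree: the leaves are the
   sides, and a node is a cell with base side (b, a) and third vertex g. *)
Inductive tri (e : nat -> nat -> bool) : nat -> nat -> Prop :=
| TriSide b : e b b.+1 -> tri e b b.+1
| TriCell b g a : e b a -> tri e b g -> tri e g a -> tri e b a.

Lemma tri_lt e b a : tri e b a -> (b < a)%N.
Proof. by elim=> // {}b g {}a _ _ bg _; apply: ltn_trans. Qed.

Lemma tri_edge e b a : tri e b a -> e b a.
Proof. by case. Qed.

(** * Positions of the vertices, counted from the base edge *)

Section Positions.

Variables (n : nat) (hn : (3 <= n)%N) (i : int).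

(** Position k counts clockwise from v_i, so the base edge joins positions 0 and n - 1 and chords
    become pairs of naturals. *)
Definition vert (k : nat) : 'Z_n := vtx n (i + k%:Z).

Definition offset (x : 'Z_n) : nat := val (x - vert 0).

Let n_gt1 : (1 < n)%N := ltnW hn.

Lemma vert_sub k l : (k <= l)%N -> vert l - vert k = (l - k)%:R :> 'Z_n.
Proof.
move=> kl; rewrite /vert /vtx -rmorphB /=.
have -> : i + l%:Z - (i + k%:Z) = (l - k)%:Z by lia.
by rewrite pmulrn.
Qed.

Lemma val_vert_sub k l : (k <= l)%N -> (l < n)%N ->
  val (vert l - vert k) = (l - k)%N.
Proof.
by move=> kl ln; rewrite vert_sub //= val_Zp_nat // modn_small //; lia.
Qed.

Lemma vert_periodic k : vert (k + n) = vert k.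
Proof.
apply/eqP; rewrite -subr_eq0 vert_sub ?leq_addr// addKn.
by apply/eqP/val_inj; rewrite /= val_Zp_nat // modnn.
Qed.

Lemma vertS k : vert k.+1 = vert k + 1.
Proof. by rewrite /vert /vtx -(addn1 k) PoszD addrA rmorphD. Qed.

Lemma val_vert_sub_wrap k l : (k < l)%N -> (l < n)%N ->
  val (vert k - vert l) = (k + n - l)%N.
Proof.
move=> kl ln; rewrite -(vert_periodic k) vert_sub; last by lia.
by rewrite /= val_Zp_nat // modn_small //; lia.
Qed.

Lemma offset_vert k : (k < n)%N -> offset (vert k) = k.
Proof. by move=> kn; rewrite /offset val_vert_sub // subn0. Qed.

Lemma vert_offset x : vert (offset x) = x.
Proof.
apply/(addIr (- vert 0)); rewrite vert_sub // subn0 /offset.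
exact: natr_Zp.
Qed.

Lemma offset_lt x : (offset x < n)%N.
Proof. by rewrite -[X in (_ < X)%N](Zp_cast n_gt1) /offset ltn_ord. Qed.

Lemma vert_inj k l : (k < n)%N -> (l < n)%N -> vert k = vert l -> k = l.
Proof. by move=> kn ln /(congr1 offset); rewrite !offset_vert. Qed.

Lemma eq_vert k l : (k < n)%N -> (l < n)%N -> (vert k == vert l) = (k == l).
Proof. by move=> kn ln; apply/eqP/eqP => [/vert_inj->|->]. Qed.

Lemma vert_pair_inj x y x' y' : (x < y < n)%N -> (x' < y' < n)%N ->
  [set vert x; vert y] = [set vert x'; vert y'] -> x = x' /\ y = y'.
Proof.
move=> xy xy' E.
have := set21 (vert x) (vert y); have := set22 (vert x) (vert y).
by rewrite E !inE !eq_vert; lia.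
Qed.

Lemma side_vert x y : (x < y < n)%N ->
  side (vert x) (vert y) = (y == x.+1) || (x == 0%N) && (y == n.-1).
Proof.
move=> xyn; rewrite /side -!vertS eq_vert; try lia.
congr (_ || _); case: (ltnP y.+1 n) => yn; first by rewrite eq_vert; lia.
have -> : y.+1 = (0 + n)%N by lia.
rewrite vert_periodic eq_vert; lia.
Qed.

Lemma crossing_vert b x a y : (b < x)%N -> (x < a)%N -> (a < y)%N -> (y < n)%N ->
  crossing (vert b) (vert a) (vert x) (vert y).
Proof.
move=> bx xa ay yn; rewrite /crossing /open_arc !inE.
rewrite !(@val_vert_sub b) ?(@val_vert_sub a y) ?(@val_vert_sub_wrap b a); lia.
Qed.

Definition arc (b a : nat) : {set 'Z_n} := [set x | (b <= offset x <= a)%N].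

Lemma mem_arc b a k : (k < n)%N -> (vert k \in arc b a) = (b <= k <= a)%N.
Proof. by move=> kn; rewrite inE offset_vert. Qed.

Lemma card_arc b a : (a < n)%N -> (#|arc b a| <= a.+1 - b)%N.
Proof.
move=> an; suff -> : (a.+1 - b = size (iota b (a.+1 - b)))%N.
  rewrite -(size_map vert); apply: leq_trans (card_size _).
  apply/subset_leq_card/subsetP => x; rewrite inE => bxa.
  by rewrite -(vert_offset x) map_f // mem_iota; lia.
by rewrite size_iota.
Qed.

(** * Non-crossing edges and the tree of cells *)

Section Edges.

Variables (T : {set {set 'Z_n}}) (hT : is_triangulation T).

Definition edge_at (x y : nat) : bool := edge T (vert x) (vert y).

Lemma edge_atE x y : (x < y < n)%N ->
  edge_at x y =
  [|| y == x.+1, (x == 0%N) && (y == n.-1) | [set vert x; vert y] \in T].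
Proof. by move=> xyn; rewrite /edge_at /edge side_vert // orbA. Qed.

Lemma edge_base : edge_at 0 n.-1.
Proof. by rewrite edge_atE ?eqxx ?orbT //; lia. Qed.

Lemma edge_noncrossing b x a y : (b < x)%N -> (x < a)%N -> (a < y)%N ->
  (y < n)%N -> edge_at b a -> edge_at x y -> False.
Proof.
move=> bx xa ay yn; rewrite !edge_atE; try lia.
move=> /or3P[|| ba]; try lia; move=> /or3P[|| xy]; try lia.
have := triang_noncrossing hT ba xy.
by rewrite crossing_vert.
Qed.

(** An edge passing strictly over g crosses (b, g) unless it starts at b, and crosses (g, a) unless
    it ends at a. *)
Lemma edge_split b g a x y : (b < g < a)%N -> (a < n)%N ->
  edge_at b g -> edge_at g a -> (b <= x)%N -> (x < y)%N -> (y <= a)%N ->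
  edge_at x y -> [\/ x = b /\ y = a, (y <= g)%N | (g <= x)%N].
Proof.
move=> bga an bg ga bx xy ya exy.
case: (leqP y g) => yg; first by constructor 2.
case: (leqP g x) => xg; first by constructor 3.
constructor 1; split.
  apply/eqP; rewrite eqn_leq bx andbT leqNgt; apply/negP => bx'.
  by apply: (edge_noncrossing bx' xg yg _ bg exy); lia.
apply/eqP; rewrite eqn_leq ya leqNgt; apply/negP => ya'.
by apply: (edge_noncrossing xg yg ya' _ exy ga).
Qed.

Lemma base_notin : [set vert 0; vert n.-1] \notin T.
Proof.
apply/negP => /(triang_diag hT) [u [v [uv suv def_e]]].
have := set21 u v; have := set22 u v; rewrite -def_e !inE.
have S0 : side (vert 0) (vert n.-1) by rewrite side_vert; lia.
move=> /orP[]/eqP Hv /orP[]/eqP Hu; move: uv suv; rewrite Hu Hv ?eqxx //.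
  by rewrite /side orbC => _; move: S0; rewrite /side => ->.
by rewrite S0.
Qed.

Section TightCount.

(** The base edge is added so that the root chord counts itself, as any diagonal does; the total n -
    2 is then exactly the bound a - b - 1 at the root. *)
Let dgs : {set {set 'Z_n}} := [set vert 0; vert n.-1] |: T.

Let dgsP e : e \in dgs ->
  exists x y, [/\ (x.+1 < y)%N, (y < n)%N, e = [set vert x; vert y] & edge_at x y].
Proof.
rewrite !inE => /orP[/eqP->|eT].
  by exists 0%N, n.-1; split=> //; rewrite ?edge_base //; lia.
have [u [v [uv suv def_e]]] := triang_diag hT eT.
wlog ltuv : u v uv suv def_e / (offset u < offset v)%N.
  move=> W; case: (ltngtP (offset u) (offset v)) => H; first exact: (W u v).
    apply: (W v u) => //; first by rewrite eq_sym.
      by rewrite /side orbC.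
    by rewrite setUC.
  by move: uv; rewrite -(vert_offset u) -(vert_offset v) H eqxx.
have Hv := offset_lt v.
exists (offset u), (offset v); rewrite !vert_offset; split => //.
  rewrite ltn_neqAle ltuv andbT; apply: contraNneq suv => H.
  by rewrite -(vert_offset u) -(vert_offset v) side_vert -H ?eqxx //; lia.
by rewrite /edge_at !vert_offset /edge -def_e eT orbT.
Qed.

Let card_dgs : #|dgs| = (n - 2)%N.
Proof.
rewrite cardsU1 (triang_card hT).
by rewrite base_notin; lia.
Qed.

Let inner b a := [set e in dgs | e \subset arc b a].

Let mem_inner b a e : (e \in inner b a) = (e \in dgs) && (e \subset arc b a).
Proof. by rewrite inE. Qed.

Let arc_pair b a x y : (x < n)%N -> (y < n)%N ->
  ([set vert x; vert y] \subset arc b a) = (b <= x <= a)%N && (b <= y <= a)%N.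
Proof. by move=> xn yn; rewrite subUset !sub1set !mem_arc. Qed.

Let inner_side b : (b.+1 < n)%N -> inner b b.+1 = set0.
Proof.
move=> bn; apply/setP=> e; rewrite [RHS]inE mem_inner.
apply/negP => /andP[/dgsP[x [y [xy yn -> _]]]].
by rewrite arc_pair; lia.
Qed.

(* The apex is the last vertex before a that is joined to b. *)
Let apex b a : (b.+1 < a)%N -> (a < n)%N ->
  exists g, [/\ (b < g < a)%N, edge_at b g & (#|inner b a| <=
    #|inner b g| + #|inner g a| + ([set vert b; vert a] \in dgs))%N].
Proof.
move=> ba an; pose P g := (b < g < a)%N && edge_at b g.
have exP : exists g, P g by exists b.+1; rewrite /P edge_atE ?eqxx; lia.
have ubP g : P g -> (g <= a)%N by rewrite /P; lia.
case: (ex_maxnP exP ubP) => g /andP[bga ebg] maxg.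
exists g; split=> //.
pose D := [set [set vert b; vert a]] :&: dgs.
have cD : (#|D| <= ([set vert b; vert a] \in dgs))%N.
  rewrite /D; case: (boolP (_ \in dgs)) => [_|badgs].
    by rewrite (leq_trans (subset_leq_card (subsetIl _ _))) ?cards1.
  rewrite leqn0 cards_eq0; apply/eqP/setP => e; rewrite in_setI in_set1 in_set0.
  by apply: contraNF badgs => /andP[/eqP->].
suff sub : inner b a \subset (inner b g :|: inner g a) :|: D.
  apply: leq_trans (subset_leq_card sub) _.
  apply: leq_trans (leq_card_setU _ _).1 _.
  by apply: leq_add cD; exact: (leq_card_setU _ _).1.
apply/subsetP => e.
rewrite mem_inner => /andP[edgs]; have [x [y [xy yn def_e exy]]] := dgsP edgs.
rewrite in_setU in_setI in_set1 edgs andbT in_setU !mem_inner edgs.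
rewrite def_e /= !arc_pair; try lia.
move=> xyba; rewrite ?andbT.
case: (leqP y g) => yg; first by apply/orP; left; lia.
case: (leqP g x) => xg; first by apply/orP; left; lia.
(* An edge over g starts at b, as otherwise it crosses (b, g); maximality of g then makes it end at
   a. *)
apply/orP; right.
have xb : x = b.
  apply/eqP; rewrite eqn_leq [(b <= x)%N](_ : _ = true) ?andbT; last by lia.
  rewrite leqNgt; apply/negP => bx'.
  by apply: (edge_noncrossing bx' xg yg _ ebg exy); lia.
have [->|ya] := eqVneq y a; first by rewrite xb.
have /maxg : P y by rewrite /P; move: exy; rewrite xb => ->; lia.
lia.
Qed.

(** By induction at the apex: the two parts give g - b - 1 and a - g - 1, and the chord (b, a)
    itself adds at most one. *)
Let card_inner_le b a : (b < a)%N -> (a < n)%N -> (#|inner b a| <= a - b - 1)%N.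
Proof.
have [m] := ubnP (a - b); elim: m => // m IH in b a *.
move=> abm ba an; have [->|ba'] := eqVneq a b.+1.
  by rewrite inner_side ?cards0; lia.
have [||g [bga _ H]] := @apex b a; try lia.
have Hbg : (#|inner b g| <= g - b - 1)%N by apply: IH; lia.
have Hga : (#|inner g a| <= a - g - 1)%N by apply: IH; lia.
by lia.
Qed.

(** Equality in the bound forces (b, a) to be present and equality in both parts, so the apex gives
    a cell and the induction continues on both sides. *)
Let tri_tight b a : (b < a)%N -> (a < n)%N -> #|inner b a| = (a - b - 1)%N ->
  tri edge_at b a.
Proof.
have [m] := ubnP (a - b); elim: m => // m IH in b a *.
move=> abm ba an; have [-> _|ba'] := eqVneq a b.+1.
  by constructor; rewrite edge_atE ?eqxx; lia.
have [||g [bga _ H]] := @apex b a; try lia.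
move=> tight.
have Hbg : (#|inner b g| <= g - b - 1)%N by apply: card_inner_le; lia.
have Hga : (#|inner g a| <= a - g - 1)%N by apply: card_inner_le; lia.
have edgs : [set vert b; vert a] \in dgs by lia.
apply: (@TriCell _ b g a).
- have [x [y [xy yn E exy]]] := dgsP edgs.
  by case: (vert_pair_inj _ _ E) => [||-> ->]; try lia.
- by apply: IH; lia.
- by apply: IH; lia.
Qed.

Lemma tri_root : tri edge_at 0 n.-1.
Proof.
apply: tri_tight; try lia.
suff -> : inner 0 n.-1 = dgs by rewrite card_dgs; lia.
apply/setP=> e; rewrite mem_inner; have [/dgsP[x [y [xy yn -> _]]]|//] := boolP (e \in dgs).
by rewrite arc_pair; lia.
Qed.

End TightCount.

(** * Counting cells and neighbours at a vertex *)

(** A sum of indicators, so that the recursion along the tree can be checked one cell at a time. *)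
Definition cells_at (b a j : nat) : nat :=
  (\sum_(C in cells T) (C \subset arc b a) && (vert j \in C))%N.

Lemma edge_sym (x y : 'Z_n) : edge T x y = edge T y x.
Proof. by rewrite /edge /side orbC setUC orbC; congr (_ || _); rewrite orbC. Qed.

Lemma card_triple b g a : (b < g < a)%N -> (a < n)%N ->
  #|[set vert b; vert g; vert a]| = 3%N.
Proof.
move=> bga an; rewrite setUC cardsU1 cards2 !inE !eq_vert; lia.
Qed.

Lemma triple_cells b g a : (b < g < a)%N -> (a < n)%N ->
  edge_at b g -> edge_at g a -> edge_at b a ->
  [set vert b; vert g; vert a] \in cells T.
Proof.
rewrite /edge_at => bga an bg ga ba; rewrite inE card_triple //=.
apply/forall_inP => x; rewrite !inE -orbA => /or3P[]/eqP->;
  apply/forall_inP => y; rewrite !inE -orbA => /or3P[]/eqP->;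
  by rewrite ?eqxx // ?bg ?ga ?ba ?implybT // edge_sym ?bg ?ga ?ba implybT.
Qed.

Lemma cell_edge C x y : C \in cells T -> x \in C -> y \in C ->
  (offset x < offset y)%N -> edge_at (offset x) (offset y).
Proof.
rewrite inE => /andP[_ /forall_inP H] xC yC xy.
rewrite /edge_at !vert_offset.
move/forall_inP: (H x xC) => /(_ y yC)/implyP; apply.
by apply: contraTneq xy => ->; rewrite ltnn.
Qed.

(** A cell contained in neither part has a vertex x before g and a vertex z after g. By
    [edge_split], a vertex before g is joined to z and must be b, and a vertex after g is joined to
    x and must be a. *)
Lemma cell_sub_cell b g a C : (b < g < a)%N -> (a < n)%N ->
  edge_at b g -> edge_at g a -> C \in cells T -> C \subset arc b a ->
  [\/ C \subset arc b g, C \subset arc g a | C = [set vert b; vert g; vert a]].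
Proof.
move=> bga an bg ga Ccell Cba.
have bnd x : x \in C -> (b <= offset x <= a)%N.
  by move=> /(subsetP Cba); rewrite inE.
case: (boolP (C \subset arc b g)) => [|/subsetPn[z zC zg]]; first by constructor 1.
case: (boolP (C \subset arc g a)) => [|/subsetPn[x xC xg]]; first by constructor 2.
constructor 3; have := bnd z zC; have := bnd x xC.
move: xg zg; rewrite !inE => xg zg Hx Hz.
have split3 u v : u \in C -> v \in C -> (offset u < offset v)%N ->
    [\/ offset u = b /\ offset v = a, (offset v <= g)%N | (g <= offset u)%N].
  move=> uC vC uv; have Hu := bnd u uC; have Hv := bnd v vC.
  move: Hu Hv => /andP[Hu _] /andP[_ Hv].
  by apply: (@edge_split b g a); rewrite ?(cell_edge Ccell).
apply/eqP; rewrite eqEcard card_triple // ; apply/andP; split; last first.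
  by move: Ccell; rewrite inE => /andP[/eqP->].
apply/subsetP => y yC; have Hy := bnd y yC.
suff : [|| offset y == b, offset y == g | offset y == a].
  by move=> /or3P[] /eqP E; rewrite -(vert_offset y) E !inE eqxx ?orbT.
case: (ltngtP (offset y) g) => yg; rewrite ?orbT //.
- have yz : (offset y < offset z)%N by lia.
  by case: (split3 y z yC zC yz) => [[]||]; lia.
- have xy : (offset x < offset y)%N by lia.
  by case: (split3 x y xC yC xy) => [[]||]; lia.
Qed.

Lemma cells_at_cell b g a j : (b < g < a)%N -> (a < n)%N -> (j < n)%N ->
  edge_at b g -> edge_at g a -> edge_at b a ->
  cells_at b a j = ((j \in [:: b; g; a]) + cells_at b g j + cells_at g a j)%N.
Proof.
move=> bga an jn bg ga ba; pose C0 := [set vert b; vert g; vert a].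
have C0cell : C0 \in cells T by apply: triple_cells.
have -> : (j \in [:: b; g; a]) =
    (\sum_(C in cells T) (C == C0) && (vert j \in C0))%N :> nat.
  rewrite (bigD1 C0) //= eqxx big1 ?addn0 /=; last first.
    by move=> C /andP[_ /negPf->].
  by rewrite !inE !eq_vert -?orbA //; lia.
rewrite /cells_at -!big_split /=; apply: eq_bigr => C Ccell.
have sub_arc b' a' : (b <= b')%N -> (a' <= a)%N ->
    C \subset arc b' a' -> C \subset arc b a.
  move=> bb' aa' /subsetP H; apply/subsetP => x /H; rewrite !inE.
  by move=> /andP[/(leq_trans bb')-> /leq_trans->].
have [/ltnW bg' /ltnW ga'] := andP bga.
have C3 : #|C| = 3%N by move: Ccell; rewrite inE => /andP[/eqP].
have [->|CC0] := eqVneq C C0.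
  have nsub b' a' k : (k < n)%N -> vert k \in C0 -> ~~ (b' <= k <= a')%N ->
      (C0 \subset arc b' a') = false.
    by move=> kn kC0; apply: contraNF => /subsetP/(_ _ kC0); rewrite mem_arc.
  rewrite (@nsub b g a) ?(@nsub g a b) ?inE ?eqxx ?orbT //; [|clear -bga an; lia..].
  suff -> : C0 \subset arc b a by rewrite !addn0.
  by rewrite !subUset !sub1set !mem_arc; lia.
case: (boolP (C \subset arc b g)) => Cbg.
  rewrite (sub_arc b g) //.
  suff -> : (C \subset arc g a) = false by rewrite addn0.
  (* The two arcs share only the vertex g, so a cell cannot lie in both. *)
  apply: contraTF isT => Cga; suff : (#|C| <= 1)%N by rewrite C3.
  rewrite -(cards1 (vert g)); apply/subset_leq_card/subsetP => x xC.
  have := subsetP Cbg _ xC; have := subsetP Cga _ xC; rewrite !inE.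
  move=> /andP[H1 _] /andP[_ H2]; rewrite -(vert_offset x).
  by apply/eqP; congr vert; apply/eqP; rewrite eqn_leq H1 H2.
case: (boolP (C \subset arc g a)) => Cga.
  by rewrite (sub_arc g a).
case: (boolP (C \subset arc b a)) => // Cba.
by case: (cell_sub_cell bga an bg ga Ccell Cba) => H;
  [rewrite H in Cbg | rewrite H in Cga | rewrite H eqxx in CC0].
Qed.

Lemma cells_at_out b a j : (j < n)%N -> ~~ (b <= j <= a)%N -> cells_at b a j = 0%N.
Proof.
move=> jn jba; rewrite /cells_at big1 // => C _.
apply/eqP; rewrite eqb0; apply/negP => /andP[/subsetP H /H].
by rewrite mem_arc // (negPf jba).
Qed.

Lemma cells_at_side b j : (b.+1 < n)%N -> cells_at b b.+1 j = 0%N.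
Proof.
move=> bn; rewrite /cells_at big1 // => C; rewrite inE => /andP[/eqP C3 _].
apply/eqP; rewrite eqb0; apply/negP => /andP[/subset_leq_card H _].
by have := leq_trans H (card_arc b bn); rewrite C3; lia.
Qed.

Lemma cells_at_all j : cells_at 0 n.-1 j = quiddity T (i + j%:Z).
Proof.
rewrite /quiddity -sum1_card /cells_at big_mkcond [RHS]big_mkcond /=.
apply: eq_bigr => C _; rewrite !inE -/(vert j).
have -> : C \subset arc 0 n.-1.
  by apply/subsetP => x _; rewrite inE; have := offset_lt x; lia.
by case: ifP => //= _; case: (_ \in C).
Qed.

Lemma cells_at_gt0 b a j : tri edge_at b a -> (b.+1 < a)%N -> (a < n)%N ->
  (b <= j <= a)%N -> (0 < cells_at b a j)%N.
Proof.
move=> t; elim: t j => [{}b _|{}b g {}a ba tbg IHl tga IHr] j; first by rewrite ltnn.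
move=> _ an jba; have bg := tri_lt tbg; have ga := tri_lt tga.
rewrite (@cells_at_cell b g a) ?(tri_edge tbg) ?(tri_edge tga) //; try lia.
rewrite !inE; have [|jb] := eqVneq j b => //=; have [|jg] := eqVneq j g => //=.
have [|ja] := eqVneq j a => //=.
case: (ltnP j g) => jg'; first by have := IHl j; lia.
by have := IHr j; lia.
Qed.

(* Unlike descendant_degree, this counts the base edge when k = n - 1. *)
Definition lower_nbrs (b k : nat) : nat :=
  #|[set t : 'I_n | [&& b <= t, t.+1 < k & edge_at t k]%N]|.

Lemma lower_nbrs_side b : lower_nbrs b b.+1 = 0%N.
Proof.
by apply/eqP; rewrite cards_eq0; apply/eqP/setP => t; rewrite !inE; lia.
Qed.

(** The additional neighbour is b; one strictly between b and g would give an edge to a crossing (b,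
    g). *)
Lemma lower_nbrs_cell b g a : (b < g < a)%N -> (a < n)%N ->
  edge_at b g -> edge_at g a -> edge_at b a ->
  lower_nbrs b a = (lower_nbrs g a).+1.
Proof.
move=> bga an bg ga ba; have bn : (b < n)%N by lia.
rewrite -[RHS]add1n /lower_nbrs.
rewrite (cardsD1 (Ordinal bn)) inE /= ba leqnn /= [X in (X + _)%N](_ : _ = 1%N); last by lia.
congr (1 + #|pred_of_set _|)%N; apply/setP => t; rewrite !inE -val_eqE /=.
have [bt|bt] := eqVneq (t : nat) b; first by rewrite /= bt; lia.
have [ta|] := ltnP t.+1 a; last by rewrite !andbF.
have [eta|] := boolP (edge_at t a); last by rewrite !andbF.
rewrite /= !andbT; case: (leqP g t) => gt; first by lia.
apply/negbTE/negP => bt'.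
have {}bt : (b < t)%N by rewrite ltn_neqAle eq_sym bt.
by apply: (edge_noncrossing bt gt _ an bg eta); lia.
Qed.

(** A neighbour of j before b would give an edge crossing (b, a). *)
Lemma lower_nbrs_inner b a j : (b < j < a)%N -> (a < n)%N -> edge_at b a ->
  lower_nbrs 0 j = lower_nbrs b j.
Proof.
move=> bja an ba; congr #|pred_of_set _|; apply/setP => t; rewrite !inE.
have [tj|] := boolP (edge_at t j); last by rewrite !andbF.
have [bt|bt] := leqP b t => //=; apply/negbTE/negP => tj'.
by apply: (edge_noncrossing bt _ _ an tj ba); lia.
Qed.

(** Both counts grow by one at each cell of the fan at a. This turns descendant degrees, which count
    diagonals, into numbers of cells. *)
Lemma lower_nbrs_cells b a : tri edge_at b a -> (a < n)%N ->
  lower_nbrs b a = cells_at b a a.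
Proof.
elim=> [{}b _ bn|{}b g {}a ba tbg _ tga IH an].
  by rewrite lower_nbrs_side cells_at_side.
have bg := tri_lt tbg; have ga := tri_lt tga.
rewrite (@cells_at_cell b g a) ?(tri_edge tbg) ?(tri_edge tga) //; try lia.
rewrite (@lower_nbrs_cell b g a) ?(tri_edge tbg) ?(tri_edge tga) //; try lia.
rewrite IH // !inE eqxx !orbT (@cells_at_out b g); lia.
Qed.

Let index_le (t k : nat) : (i + t%:Z <= i + k%:Z - 2) = (t.+1 < k)%N.
Proof. lia. Qed.

Lemma descendant_degree_lower k : (k < n.-1)%N ->
  descendant_degree T i (i + k%:Z) = lower_nbrs 0 k.
Proof.
move=> kn; congr #|pred_of_set _|; apply/setP => t; rewrite !inE.
rewrite index_le.
have [tk|//] := ltnP t.+1 k; rewrite edge_atE /=; last by lia.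
by rewrite setUC -/(vert t) -/(vert k) (gtn_eqF tk) (ltn_eqF kn) andbF.
Qed.

Lemma descendant_degree_last :
  (descendant_degree T i (i + n.-1%:Z)).+1 = lower_nbrs 0 n.-1.
Proof.
have n0 : (0 < n)%N by lia.
rewrite /lower_nbrs (cardsD1 (Ordinal n0)) inE edge_base andbT /=.
rewrite [X in (X + _)%N](_ : _ = 1%N); last by lia.
rewrite add1n; congr (_.+1); congr #|pred_of_set _|; apply/setP => t.
rewrite !inE -val_eqE /= index_le.
have [tk|] := ltnP t.+1 n.-1; last by rewrite !andbF.
rewrite edge_atE /=; last by lia.
rewrite setUC -/(vert t) -/(vert n.-1).
rewrite (gtn_eqF tk) eqxx andbT -lt0n; case: (posnP t) => t0 //=.
by rewrite t0; apply/negbTE/base_notin.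
Qed.

End Edges.
End Positions.

(** * Sums of q-integers *)

Lemma qint0 : qint 0 = 0.
Proof. by rewrite /qint big_ord0. Qed.

Lemma qintD a b : qint (a + b) = qint a + 'X^a * qint b.
Proof.
rewrite /qint big_split_ord /= mulr_sumr; congr (_ + _).
by apply: eq_bigr => j _; rewrite exprD.
Qed.

Lemma qint1 : qint 1 = 1.
Proof. by rewrite /qint big_ord1 expr0. Qed.

(** * Farey labels along the fan of cells at a vertex, with [f] standing for r or s *)

Section FareyFans.

Variables (n : nat) (hn : (3 <= n)%N) (i : int).
Variables (T : {set {set 'Z_n}}) (hT : is_triangulation T).
Variables (f : nat -> {poly int}) (w : nat -> nat -> int).

Hypothesis f_cell : forall b g a l, (b < g)%N -> (g < a)%N -> (a < n)%N ->
  [set vert n i b; vert n i g; vert n i a] \in cells T -> w b a = l%:Z - 1 ->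
  [/\ f g = f a + 'X^l * f b, w g a = 0 & w b g = l%:Z].

Let e := edge_at i T.
Let cnt := cells_at i T.

Let f_tri b g a l : e b a -> tri e b g -> tri e g a -> (a < n)%N ->
  w b a = l%:Z - 1 -> [/\ f g = f a + 'X^l * f b, w g a = 0 & w b g = l%:Z].
Proof.
move=> ba tbg tga an wba; have bg := tri_lt tbg; have ga := tri_lt tga.
apply: f_cell => //; apply: triple_cells => //; rewrite ?bg //.
  exact: tri_edge tbg.
exact: tri_edge tga.
Qed.

Let cnt_tri b g a j : e b a -> tri e b g -> tri e g a -> (a < n)%N ->
  (b <= j <= a)%N ->
  cnt b a j = ((j \in [:: b; g; a]) + cnt b g j + cnt g a j)%N.
Proof.
move=> ba tbg tga an /andP[_ ja]; have bg := tri_lt tbg; have ga := tri_lt tga.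
apply: cells_at_cell => //; rewrite ?bg ?(leq_ltn_trans ja) //.
  exact: tri_edge tbg.
exact: tri_edge tga.
Qed.

(** Along the fan at b, each cell moves the far vertex closer to b and raises the weight of the
    chord at b by a factor q. The added multiples q^l, q^(l+1), ... of [f b] sum to q^l times a
    q-integer. *)
Lemma farey_next b a l : tri e b a -> (a < n)%N -> w b a = l%:Z - 1 ->
  f b.+1 = f a + 'X^l * qint (cnt b a b) * f b /\
  w b b.+1 = (l + cnt b a b)%:Z - 1.
Proof.
move=> t; elim: t l => [{}b _|{}b g {}a ba tbg IH tga _] l an wba.
  by rewrite /cnt cells_at_side // qint0 addn0; split=> //; ring.
have bg := tri_lt tbg; have ga := tri_lt tga.
have [fg _ wbg] := f_tri ba tbg tga an wba.
have [||-> ->] := IH l.+1; [lia|rewrite wbg; lia|].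
have -> : cnt b a b = (1 + cnt b g b)%N.
  rewrite (cnt_tri ba tbg tga an) ?leqnn /=; last by lia.
  by rewrite [cnt g a b](cells_at_out hn); rewrite ?inE ?eqxx //=; lia.
split; last by lia.
by rewrite fg qintD qint1 exprS expr1; ring.
Qed.

(* This identity and the next are multiplied by q, because the weight of the
   base edge is q^-1. *)
Lemma farey_prev b a l : tri e b a -> (a < n)%N -> w b a = l%:Z - 1 ->
  exists2 m : nat, w a.-1 a = m%:Z - 1 &
  'X^m * f a.-1 = 'X * qint (cnt b a a) * f a + 'X^(l + cnt b a a) * f b.
Proof.
move=> t; elim: t l => [{}b _|{}b g {}a ba tbg _ tga IH] l an wba.
  exists l => //; rewrite /cnt cells_at_side // qint0 addn0 /=; ring.
have bg := tri_lt tbg; have ga := tri_lt tga.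
have [fg wga _] := f_tri ba tbg tga an wba.
(* The side (g, a) has weight 1 = q^(1-1), hence the instance l = 1. *)
have [||m wm fm] := IH 1%N; [lia|rewrite wga; lia|].
exists m => //; rewrite {}fm.
have -> : cnt b a a = (cnt g a a + 1)%N.
  rewrite (cnt_tri ba tbg tga an) ?leqnn ?andbT /=; last by lia.
  rewrite [cnt b g a](cells_at_out hn); rewrite ?inE ?eqxx ?orbT //=; lia.
rewrite fg qintD qint1 !exprD expr1.
by move: 'X^(cnt g a a) 'X^l (qint _) => *; ring.
Qed.

Lemma farey_inner b a l j : tri e b a -> (a < n)%N -> w b a = l%:Z - 1 ->
  (b < j < a)%N ->
  w j j.+1 = (cnt b a j)%:Z - (lower_nbrs i T 0 j)%:Z - 1 /\
  exists2 m : nat, w j.-1 j = m%:Z - 1 &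
  'X^((lower_nbrs i T 0 j).+1) * f j.+1 =
    'X * qint (cnt b a j) * f j - 'X^m * f j.-1.
Proof.
move=> t; elim: t l => [{}b _|{}b g {}a ba tbg IHl tga IHr] l an wba; first by lia.
have bg := tri_lt tbg; have ga := tri_lt tga => bja.
have [fg wga wbg] := f_tri ba tbg tga an wba.
rewrite (cnt_tri ba tbg tga an); last by lia.
have [jg|gj|->] := ltngtP j g.
- rewrite [cnt g a j](cells_at_out hn); [|lia..].
  rewrite !inE [_ || _](_ : _ = false) ?addn0; last by lia.
  by apply: (IHl l.+1); rewrite ?wbg; lia.
- rewrite [cnt b g j](cells_at_out hn); [|lia..].
  rewrite !inE [_ || _](_ : _ = false) ?addn0; last by lia.
  by apply: (IHr 1%N); rewrite ?wga; lia.
(* Here j is the third vertex of the cell b < g < a. The other cells at g form a fan below (b, g)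
   and a fan below (g, a); [farey_prev] and [farey_next] describe them, and the cell relation for
   [f g] eliminates [f a] and [f b]. *)
have -> : lower_nbrs i T 0 g = cnt b g g.
  rewrite (lower_nbrs_inner hn hT (b := b) (a := a)) ?bg //.
  by apply: lower_nbrs_cells => //; lia.
have [||fSg wgSg] := farey_next (l := 1) tga; [lia|rewrite wga; lia|].
have [||m wm fm] := farey_prev (l := l.+1) tbg; [lia|rewrite wbg; lia|].
rewrite !inE eqxx orbT /=; split; first by rewrite wgSg; lia.
exists m => //; rewrite fm fSg [(true + _)%N]addnC !qintD qint1 fg !(exprS, exprD) !expr0.
by move: 'X^(cnt b g g) 'X^l (qint _) (qint _) => *; ring.
Qed.

(** At q = 1 the label of g is the sum of those of b and a. Only the value at b may vanish, as s
    does at v_i; the third vertex g is positive, so both parts inherit the hypotheses. *)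
Lemma farey_gt0 b a l j : tri e b a -> (a < n)%N -> w b a = l%:Z - 1 ->
  0 <= (f b).[1] -> 0 < (f a).[1] -> (b < j <= a)%N -> 0 < (f j).[1].
Proof.
move=> t; elim: t l => [{}b _|{}b g {}a ba tbg IHl tga IHr] l an wba fb fa.
  by rewrite -eqn_leq => /eqP<-.
have bg := tri_lt tbg; have ga := tri_lt tga => bja.
have [fg wga wbg] := f_tri ba tbg tga an wba.
have fg0 : 0 < (f g).[1].
  by rewrite fg hornerD hornerM hornerXn expr1n mul1r ltr_wpDr.
case: (leqP j g) => jg; first by apply: (IHl l.+1); rewrite ?wbg //; lia.
by apply: (IHr 1%N) => //; rewrite ?wga ?ltW //; lia.
Qed.

End FareyFans.

(** * From the linear recurrence to the frieze *)

Section Continuants.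

Variables (N : nat) (c : nat -> nat) (R S : nat -> {poly int}).

Let recurrence (F : nat -> {poly int}) := forall j, (j < N)%N ->
  F j.+2 = qint (c j.+1) * F j.+1 - 'X^((c j).-1) * F j.

Hypotheses (recR : recurrence R) (recS : recurrence S).
Hypotheses (R0 : R 0 = 1) (S0 : S 0 = 0) (R1 : R 1 = qint (c 0)) (S1 : S 1 = 1).
Hypothesis S_gt0 : forall k, (0 < k <= N)%N -> 0 < (S k).[1].

(** Up to a power of q these minors are the frieze entries, by [frieze_det]. *)
Let det k l := R k * S l - R l * S k.

(** A discrete Wronskian: the recurrence multiplies it by q^(c_k - 1) at each step. *)
Let det_succ k : (k <= N)%N -> det k k.+1 = 'X^(\sum_(0 <= u < k) (c u).-1).
Proof.
rewrite /det; elim: k => [_|k IH kN]; first by rewrite big_geq // R0 S0 S1 expr0; ring.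
rewrite big_nat_recr //= exprD -IH; last by lia.
by rewrite recR // recS //; ring.
Qed.

(** Since S_k is the minor of columns 0 and k, the Pluecker relation on columns 0, k, l, l + 1
    expresses the next minor times S_l through terms known to be nonnegative, the first of them
    positive. *)
Let det_gt0 k l : (k < l <= N)%N -> 0 < (det k l).[1].
Proof.
have succ_gt0 m : (m <= N)%N -> 0 < (det m m.+1).[1].
  by move=> mN; rewrite det_succ // hornerXn expr1n.
elim: l => // l IH; rewrite ltnS leq_eqVlt => /andP[/predU1P[-> /ltnW|]].
  exact: succ_gt0.
move=> kl lN.
have Sl : 0 < (S l).[1] by apply: S_gt0; lia.
have Sk : 0 <= (S k).[1].
  case: (posnP k) => [->|k0]; first by rewrite S0 horner0.
  by apply/ltW/S_gt0; lia.
rewrite -(pmulr_lgt0 _ Sl) -hornerM.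
have -> : det k l.+1 * S l = det k l * S l.+1 + det l l.+1 * S k.
  by rewrite /det; ring.
rewrite hornerD !hornerM ltr_wpDr //.
  by rewrite mulr_ge0 // ltW // succ_gt0 // ltnW.
by rewrite mulr_gt0 ?IH ?S_gt0 // ?kl ltnW.
Qed.

Let det_neq0 k l : (k < l <= N)%N -> det k l != 0.
Proof. by move=> /det_gt0; apply: contraTneq => ->; rewrite horner0 ltxx. Qed.

Variable Z : nat -> nat -> {poly int}.

Hypotheses (Z0 : forall k, Z k k = 0) (Z1 : forall k, Z k k.+1 = 1).
Hypothesis Z2 : forall k, Z k k.+2 = qint (c k.+1).
Hypothesis Z_unimodular : forall k l, (k + 3 <= l <= N.+1)%N ->
  Z k l.-1 * Z k.+1 l - Z k.+1 l.-1 * Z k l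
  = 'X^(\sum_(k.+1 <= u < l.-1) (c u).-1).

(** Induction on l - k. The Pluecker relation on columns k, k + 1, l - 1, l and the unimodular rule
    determine both sides after multiplication by the minor of k + 1 and l - 1, which is nonzero
    because it is positive at q = 1. *)
Let frieze_det k l : (k <= l <= N.+1)%N -> det k k.+1 * Z k l = det k l.
Proof.
have [m] := ubnP (l - k); elim: m => // m IH in k l *.
move=> lkm kl; have [lk|lk1] := leqP l k.
  have -> : l = k by lia.
  by rewrite Z0 /det; ring.
have [->|lk2] := eqVneq l k.+1; first by rewrite Z1 mulr1.
have [El|lk3] := eqVneq l k.+2.
  rewrite El Z2 /det recR ?recS; [|lia..].
  ring.
have Dk : det k.+1 l.-1 != 0 by apply: det_neq0; lia.
have D1 : det k.+1 k.+2 != 0 by apply: det_neq0; lia.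
have IH1 := IH k l.-1; have IH2 := IH k.+1 l; have IH3 := IH k.+1 l.-1.
have U := Z_unimodular (k := k) (l := l).
(* Both minors are powers of q; the exponent of the unimodular rule is the difference of theirs. *)
have E : det k.+1 k.+2 * 'X^(\sum_(k.+1 <= u < l.-1) (c u).-1) = det l.-1 l.
  have := @det_succ l.-1; rewrite prednK; last by lia.
  move=> ->; last by lia.
  rewrite det_succ; last by lia.
  by rewrite -exprD -(big_cat_nat (n := k.+1)) //; lia.
apply: (mulfI Dk).
have -> : det k.+1 l.-1 * det k l =
    det k l.-1 * det k.+1 l - det k k.+1 * det l.-1 l by rewrite /det; ring.
rewrite -E -U -?IH1 -?IH2 -?IH3; [|lia..].
ring.
Qed.

Lemma frieze_row0 l : (l <= N.+1)%N -> Z 0 l = S l.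
Proof.
move=> lN; have := @frieze_det 0 l lN.
by rewrite /det R0 S0 S1 !(mul1r, mulr0, subr0).
Qed.

(** The frieze row starting at i - 1, which [Z] does not reach because its indices count from i. *)
Variable Y : nat -> {poly int}.

Hypotheses (Y0 : Y 0 = 1) (Y1 : Y 1 = qint (c 0)).
Hypothesis Y_unimodular : forall l, (2 <= l <= N.+1)%N ->
  Y l.-1 * Z 0 l - Z 0 l.-1 * Y l = 'X^(\sum_(0 <= u < l.-1) (c u).-1).

(** The rule between this row and row 0, which is S, is the formula for [det l l.+1]; as S_l is
    nonzero, it determines each entry from the previous one. *)
Lemma frieze_row_pred l : (l <= N.+1)%N -> Y l = R l.
Proof.
elim: l => [_|[_ _|l IH lN]]; rewrite ?Y0 ?R0 ?Y1 ?R1 //.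
have := Y_unimodular (l := l.+2); rewrite /= lN => /(_ isT).
rewrite -det_succ // !frieze_row0 //; last by lia.
rewrite IH; last by lia.
have Sl : S l.+1 != 0.
  have : 0 < (S l.+1).[1] by apply: S_gt0; lia.
  by apply: contraTneq => ->; rewrite horner0 ltxx.
by rewrite /det => /addrI/oppr_inj; rewrite [RHS]mulrC => /(mulfI Sl).
Qed.

End Continuants.

(** * The three-term recurrence of the rescaled labels *)

Section FareyRecurrence.

Variables (n : nat) (hn : (3 <= n)%N) (i : int).
Variables (T : {set {set 'Z_n}}) (hT : is_triangulation T).
Variables (f : nat -> {poly int}) (w : nat -> nat -> int) (ell : nat -> nat).

Hypothesis f_cell : forall b g a l, (b < g)%N -> (g < a)%N -> (a < n)%N ->
  [set vert n i b; vert n i g; vert n i a] \in cells T -> w b a = l%:Z - 1 ->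
  [/\ f g = f a + 'X^l * f b, w g a = 0 & w b g = l%:Z].
Hypothesis w_base : w 0 n.-1 = -1.
Hypothesis f_antiperiodic : f n = - f 0.
Hypothesis ellS : forall k, (k < n)%N ->
  ell k.+1 = (ell k + descendant_degree T i (i + k%:Z))%N.

Let c (k : nat) := quiddity T (i + k%:Z).
Let mu (k : nat) := descendant_degree T i (i + k%:Z).

Let root := tri_root hn i hT.
Let n1n : (n.-1 < n)%N. Proof. by lia. Qed.
Let w_root : w 0 n.-1 = 0%:Z - 1. Proof. by rewrite w_base. Qed.

Lemma quiddity_gt0 k : (k < n)%N -> (0 < c k)%N.
Proof.
by move=> kn; rewrite /c -cells_at_all // cells_at_gt0 //; lia.
Qed.

Lemma farey_first : f 1 = f n.-1 + qint (c 0) * f 0.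
Proof.
have [-> _] := farey_next hn hT f_cell root n1n w_root.
by rewrite cells_at_all // expr0 mul1r.
Qed.

Let mu0 : mu 0 = 0%N.
Proof.
rewrite /mu descendant_degree_lower //; last by lia.
by apply/eqP; rewrite cards_eq0; apply/eqP/setP => t; rewrite !inE; lia.
Qed.

(** The exponent is the number of cells at v_k lying beyond the one nearest to the base edge, on the
    side of v_(k+1). *)
Let w_succ k : (k < n.-1)%N -> w k k.+1 = (c k)%:Z - (mu k)%:Z - 1.
Proof.
case: k => [|k] kn.
  have [_ ->] := farey_next hn hT f_cell root n1n w_root.
  by rewrite mu0 cells_at_all // -/(c 0); lia.
have [|-> _] := farey_inner (j := k.+1) hn hT f_cell root n1n w_root; first by [].

by rewrite cells_at_all // -descendant_degree_lower.
Qed.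

Let farey_rec k : (k.+1 < n)%N ->
  exists2 m : nat, m%:Z = (c k)%:Z - (mu k)%:Z &
  'X^((mu k.+1).+1) * f k.+2 = 'X * qint (c k.+1) * f k.+1 - 'X^m * f k.
Proof.
move=> kn; have wk := @w_succ k; have [kn1|kn1] := eqVneq k.+2 n.
  (* At the last vertex all cells lie on one side, and [f n = - f 0] turns the term in [f 0] given
     by [farey_prev] into the next label. *)
  have En : n.-1 = k.+1 by lia.
  have [m wm fm] := farey_prev hn hT f_cell root n1n w_root.
  move: wm fm; rewrite {1 2 3}En /= => wm fm; exists m.
    by rewrite wk // in wm; lia.
  have -> : (mu k.+1).+1 = cells_at i T 0 n.-1 n.-1.
    by rewrite /mu -En descendant_degree_last // lower_nbrs_cells.
  rewrite kn1 f_antiperiodic fm cells_at_all // En add0n.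
  by rewrite /c opprD addNKr mulrN.
have [|_ [m wm fm]] := farey_inner (j := k.+1) hn hT f_cell root n1n w_root.
  by lia.
exists m; first by rewrite /= wk in wm; lia.
by rewrite /mu /c -cells_at_all // descendant_degree_lower //; lia.
Qed.

(** Rescaling by q^ell absorbs the descendant degrees, so the coefficients depend on the quiddity
    alone. *)
Lemma farey_recurrence k : (k < n.-1)%N ->
  'X^(ell k.+2) * f k.+2 = qint (c k.+1) * ('X^(ell k.+1) * f k.+1)
    - 'X^((c k).-1) * ('X^(ell k) * f k).
Proof.
move=> kn; have [|m Em fm] := @farey_rec k; first by lia.
have X0 : 'X != 0 :> {poly int} by rewrite polyX_eq0.
have ck := @quiddity_gt0 k; apply: (mulfI X0).
rewrite [ell k.+2]ellS; last by lia.
have -> : 'X * ('X^(ell k.+1 + mu k.+1) * f k.+2) =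
    'X^(ell k.+1) * ('X^((mu k.+1).+1) * f k.+2).
  by rewrite exprD exprS; move: 'X^(ell _) 'X^(mu _) => *; ring.
have -> : 'X * (qint (c k.+1) * ('X^(ell k.+1) * f k.+1)
      - 'X^((c k).-1) * ('X^(ell k) * f k)) =
    'X^(ell k.+1) * ('X * qint (c k.+1) * f k.+1)
      - ('X * 'X^((c k).-1) * 'X^(ell k)) * f k.
  by move: 'X^(ell _) 'X^((c _).-1) 'X^(ell k) (qint _) => *; ring.
(* The exponents agree since m = c_k - mu_k, ell_(k+1) = ell_k + mu_k and c_k is positive. *)
have -> : 'X * 'X^((c k).-1) * 'X^(ell k) = 'X^(ell k.+1) * 'X^m :> {poly int}.
  rewrite -exprS -!exprD; congr 'X^_.
  by rewrite ellS -/(mu k); lia.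
by rewrite fm mulrBr (mulrA _ 'X^m).
Qed.

End FareyRecurrence.

(** * Identification of the rows i - 1 and i of the frieze *)

Theorem theorem3p15
  (n : nat) (hn : (3 <= n)%N)
  (T : {set {set 'Z_n}}) (hT : is_triangulation T)
  (i : int)
  (zeta : int -> int -> {poly int}) (hzeta : is_qCCF T zeta)
  (w : int -> int -> int) (r s : int -> {poly int})
  (hrs : is_qFarey T i w r s)
  (ell : int -> nat)
  (hell0 : ell (i - 1) = 0%N)
  (hell : forall j : int, i <= j -> j <= i + n%:Z - 1 ->
     (ell j)%:Z - (ell (j - 1))%:Z = (descendant_degree T i j)%:Z) :
  (forall j : int, i - 1 <= j -> j <= i + n%:Z - 1 ->
     zeta (i - 1) (j + 1) = 'X^(ell j) * r (j + 1) /\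
     zeta i (j + 1) = 'X^(ell j) * s (j + 1)) /\
  (descendant_degree T i i = 0%N /\ descendant_degree T i (i + 1) = 0%N /\
   ell i = 0%N /\ ell (i + 1) = 0%N).
Proof.
have dd0 : descendant_degree T i i = 0%N.
  by apply/eqP; rewrite cards_eq0; apply/eqP/setP => t; rewrite !inE; lia.
have dd1 : descendant_degree T i (i + 1) = 0%N.
  by apply/eqP; rewrite cards_eq0; apply/eqP/setP => t; rewrite !inE; lia.
have ell_i : ell i = 0%N by have := hell i; rewrite dd0 hell0; lia.
have ell_i1 : ell (i + 1) = 0%N.
  by have := hell (i + 1); rewrite dd1 addrK ell_i; lia.
split=> //.
pose at_i (f : int -> {poly int}) (k : nat) := f (i + k%:Z).
pose wt (b a : nat) := w (i + b%:Z) (i + a%:Z).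
(* The shift by one matches q^(ell_j) with the label of index j + 1 = i + k; thus L 0 is
   ell_(i-1). *)
pose L (k : nat) := ell (i + k%:Z - 1).
pose c (k : nat) := quiddity T (i + k%:Z).
have n1E : i + n.-1%:Z = i + n%:Z - 1 by lia.
have i0E : i + 0%:Z = i by rewrite addr0.
have cell b g a l : (b < g)%N -> (g < a)%N -> (a < n)%N ->
    [set vert n i b; vert n i g; vert n i a] \in cells T ->
    wt b a = l%:Z - 1 ->
    [/\ at_i r g = at_i r a + 'X^l * at_i r b,
        at_i s g = at_i s a + 'X^l * at_i s b, wt g a = 0 & wt b g = l%:Z].
  by move=> bg ga an C W; apply: (qFarey_cell hrs) C W; lia.
have rcell b g a l bg ga an C W :=
  let: And4 E _ W1 W2 := @cell b g a l bg ga an C W in And3 E W1 W2.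
have scell b g a l bg ga an C W :=
  let: And4 _ E W1 W2 := @cell b g a l bg ga an C W in And3 E W1 W2.
have w_base : wt 0 n.-1 = -1.
  by rewrite /wt i0E n1E (qFarey_base_weight hrs).
have [rN sN] := qFarey_last hrs; have [r0 s0] := qFarey_first hrs.
rewrite -n1E in rN sN; rewrite -i0E in r0 s0.
have [rn sn] : at_i r n = - at_i r 0 /\ at_i s n = - at_i s 0.
  have [||] := qFarey_antiperiodic hrs (j := i) 1; [lia..|].
  by rewrite mul1r expr1z !mulN1r /at_i i0E.
have LS k : (k < n)%N -> L k.+1 = (L k + descendant_degree T i (i + k%:Z))%N.
  move=> kn; have := hell (i + k%:Z).
  have -> : L k.+1 = ell (i + k%:Z) by congr ell; lia.
  by rewrite /L; lia.
have L0 : L 0 = 0%N by rewrite /L i0E.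
have L1 : L 1 = 0%N by rewrite LS ?L0 ?i0E ?dd0 //; lia.
pose R k := 'X^(L k) * at_i r k; pose S k := 'X^(L k) * at_i s k.
(* With N = n - 1 the recurrence reaches position n, whose label comes from the anti-periodic
   extension. *)
have recR j (jn : (j < n.-1)%N) : R j.+2 = qint (c j.+1) * R j.+1 - 'X^((c j).-1) * R j.
  exact: (farey_recurrence hn hT rcell w_base rn LS).
have recS j (jn : (j < n.-1)%N) : S j.+2 = qint (c j.+1) * S j.+1 - 'X^((c j).-1) * S j.
  exact: (farey_recurrence hn hT scell w_base sn LS).
have R0 : R 0 = 1 by rewrite /R L0 mul1r /at_i r0.
have S0 : S 0 = 0 by rewrite /S L0 mul1r /at_i s0.
have R1 : R 1 = qint (c 0).
  rewrite /R L1 mul1r (farey_first hn hT rcell w_base).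
  by rewrite {1 2}/at_i rN r0 add0r mulr1.
have S1 : S 1 = 1.
  rewrite /S L1 mul1r (farey_first hn hT scell w_base).
  by rewrite {1 2}/at_i sN s0 mulr0 addr0.
have S_gt0 k : (0 < k <= n.-1)%N -> 0 < (S k).[1].
  move=> kn; rewrite hornerM hornerXn expr1n mul1r.
  apply: (@farey_gt0 _ hn i T (at_i s) wt scell 0 n.-1 0) => //.
  - exact: tri_root.
  - by lia.
  - by rewrite /at_i s0 horner0.
  - by rewrite /at_i sN hornerC.
pose Z (k l : nat) := zeta (i + k%:Z) (i + l%:Z).
pose Y (l : nat) := zeta (i - 1) (i + l%:Z).
have Z0 k : Z k k = 0 by apply: (qCCF0 hzeta).
have Z1 k : Z k k.+1 = 1.
  by rewrite -(qCCF1 hzeta (i + k%:Z)); congr zeta; lia.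
have Z2 k : Z k k.+2 = qint (c k.+1).
  have := qCCF2 hzeta (i + k%:Z); rewrite -!addrA => E.
  by rewrite /Z -addn2 E /c -addn1.
have Z_uni k l : (k + 3 <= l <= n.-1.+1)%N ->
    Z k l.-1 * Z k.+1 l - Z k.+1 l.-1 * Z k l =
    'X^(\sum_(k.+1 <= u < l.-1) (c u).-1).
  move=> kl; have := @qCCF_unimodular _ _ _ hzeta (i + k%:Z) (i + l%:Z).
  have -> : i + l%:Z - 1 = i + l.-1%:Z by lia.
  have -> : i + k%:Z + 1 = i + k.+1%:Z by lia.
  move=> ->; [|lia..].
  rewrite -[in RHS](add0n k.+1) big_addn; congr 'X^_.
  have -> : `|(i + l%:Z - (i + k%:Z) - 2)%R|%N = (l.-1 - k.+1)%N by lia.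
  by apply: eq_bigr => t _; congr (quiddity _ _).-1; lia.
have Y0 : Y 0 = 1.
  by rewrite -(qCCF1 hzeta (i - 1)); congr zeta; lia.
have Y1 : Y 1 = qint (c 0).
  have := qCCF2 hzeta (i - 1); rewrite subrK /c i0E => <-.
  by congr zeta; lia.
have Y_uni l : (2 <= l <= n.-1.+1)%N ->
    Y l.-1 * Z 0 l - Z 0 l.-1 * Y l = 'X^(\sum_(0 <= u < l.-1) (c u).-1).
  move=> ln; have := @qCCF_unimodular _ _ _ hzeta (i - 1) (i + l%:Z).
  have -> : i + l%:Z - 1 = i + l.-1%:Z by lia.
  have -> : i - 1 + 1 = i + 0%:Z by lia.
  move=> ->; [|lia..].
  have -> : `|(i + l%:Z - (i - 1) - 2)%R|%N = l.-1 by lia.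
  by congr 'X^_; apply: eq_bigr => t _; rewrite i0E.
move=> j ij jn; pose k := `|(j + 1 - i)%R|%N.
have -> : j + 1 = i + k%:Z by lia.
have -> : ell j = L k by congr ell; lia.
have kn : (k <= n.-1.+1)%N by lia.
rewrite -/(R k) -/(S k); split.
  exact: (frieze_row_pred recR recS R0 S0 R1 S1 S_gt0 Z0 Z1 Z2 Z_uni Y0 Y1 Y_uni).
by have := frieze_row0 recR recS R0 S0 S1 S_gt0 Z0 Z1 Z2 Z_uni kn; rewrite /Z i0E.
Qed.
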